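(* Let $k\ge1$ and let $n_1,\dots,n_k>0$ be integers. Put $n=\sum_{i=1}^k n_i$ and $p=\prod_{i=1}^k n_i$. Let $\theta\in\mathrm{Perm}(n)$ have cycles of length $n_1,\dots,n_k$. Then $$|\mathrm{Map}_0(\theta)|\le p\,n^{k-2}\,2^{n-2k+2}\,\mathbf 1\{n\ge 2k-2\}.$$
   Context: $\langle n\rangle=\{1,\dots,n\}$; $\mathrm{Perm}(n)$ is the group of bijections of $\langle n\rangle$; $c(\sigma)$ is the number of cycles of $\sigma\in\mathrm{Perm}(n)$ (fixed points count as cycles). $\mathbf 1\{\cdots\}$ is $1$ if the condition holds and $0$ otherwise. For $\theta\in\mathrm{Perm}(n)$, $\mathrm{Map}_0(\theta)$ is the set of fixed-point-free permutations $\iota\in\mathrm{Perm}(n)$ of order $2$ such that $\theta$ and $\iota$ generate a group acting transitively on $\langle n\rangle$ and $c(\theta)+c(\theta\iota)=2+n/2$. *)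

(* Defs.v *)
From HB Require Import structures.
From mathcomp Require Import all_boot all_order all_algebra all_fingroup.
Set Implicit Arguments.
Unset Strict Implicit.
Unset Printing Implicit Defensive.

Local Open Scope group_scope.

Definition ncycles (n : nat) (s : 'S_n) : nat := #|porbits s|.

Definition cycle_lengths (n : nat) (s : 'S_n) : seq nat :=
  [seq #|(C : {set 'I_n})| | C <- enum (porbits s)].

(* The product of 'S_n composes from left to right, so [theta * iota] is the
   function composite of iota after theta; the opposite composite is conjugate
   to it, hence has the same number of cycles.  The Euler relation is stated in
   rat so that n / 2 is exact division. *)
Definition Map0 (n : nat) (theta : 'S_n) : {set 'S_n} :=
  [set iota : 'S_n |
    [&& [forall x, iota x != x],
        #[iota] == 2,
        [transitive <<[set theta; iota]>>, on [set: 'I_n] | 'P] &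
        ((ncycles theta)%:R + (ncycles (theta * iota))%:R
           == 2%:R + n%:R / 2%:R :> rat)%R ] ].

(* Main.v *)
Require Import Defs.
From HB Require Import structures.
From mathcomp Require Import all_boot all_order all_algebra all_fingroup.
From mathcomp Require Import zify ring.
Import Order.TTheory GRing.Theory Num.Theory.
Local Open Scope ring_scope.

(* Read iota as the edges of a planar map whose vertices are the k cycles of
   theta.  If the edge {a, b} joins distinct cycles, it can be contracted: with
   t = (a b), replacing theta by t * theta merges the two cycles, replacing
   iota by iota * t turns a and b into fixed points, and the product
   iota * theta, hence the faces, is unchanged.  Doing this for each of the at
   least k - 1 non-loop edges and counting in two ways bounds the number of maps
   inductively: with m non-fixed points, m_i of them on the i-th cycle,
   (k - 1) M <= sum_{i < j} m_i m_j M_{ij}, and sum_{i < j} (m_i + m_j)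
   = (k - 1) m closes the induction for M 4^(k-1) <= m_1...m_k m^(k-2) 2^m.
   For k = 1 the pairing is noncrossing, so it is determined by the set of its
   opening points, which leaves at most 2^m choices. *)

Section PlanarInvolutions.
Set Implicit Arguments.
Unset Strict Implicit.
Variable T : finType.
Implicit Types (s theta iota : {perm T}) (A F : {set T}) (a b x y : T).
Local Open Scope nat_scope.

(** * Invariant sets and connectedness *)

Definition stable s A := [forall x in A, s x \in A].

Lemma stableP s A : reflect (forall x, x \in A -> s x \in A) (stable s A).
Proof. exact: forall_inP. Qed.

Lemma stable_porbit s A x y :
  stable s A -> x \in A -> y \in porbit s x -> y \in A.
Proof.
move=> /stableP sA xA /porbitP[i ->].
by elim: i => [|i IHi]; rewrite ?expg0 ?perm1 // expgSr permM sA.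
Qed.

Lemma porbit_stable s x : stable s (porbit s x).
Proof.
apply/stableP => y; rewrite -!eq_porbit_mem => /eqP <-.
by rewrite -[s y]/((s ^+ 1)%g y) porbit_perm.
Qed.

Lemma eq_in_porbit s theta x :
  {in porbit s x, s =1 theta} -> porbit s x = porbit theta x.
Proof.
move=> eqs; suff powE i : (s ^+ i)%g x = (theta ^+ i)%g x.
  by apply/setP => y; apply/porbitP/porbitP => -[i ->]; exists i.
by elim: i => [|i IHi]; rewrite ?expg0 // !expgSr !permM -IHi eqs // mem_porbit.
Qed.

(** Stands for transitivity of the generated group: on a finite set, forward stability under a
    permutation already gives invariance. This form passes easily to contracted pairs. *)
Definition connected theta iota :=
  [forall A : {set T}, stable theta A && stable iota A ==>
     (A == set0) || (A == setT)].

Lemma connectedP theta iota A x :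
  connected theta iota -> stable theta A -> stable iota A -> x \in A ->
  A = setT.
Proof.
move=> /forallP/(_ A) /implyP con tA iA xA.
by case/orP: (con (introT andP (conj tA iA))) => /eqP // A0; rewrite A0 inE in xA.
Qed.

(** * Contraction of an edge joining two cycles *)

Section Contract.
Variables (theta : {perm T}) (a b : T).
Hypothesis ab : b \notin porbit theta a.
Let theta' := (tperm a b * theta)%g.

Lemma contract_neq : a != b.
Proof. by apply: contraNneq ab => <-; apply: porbit_id. Qed.

Lemma contract_card : #|porbits theta'|.+1 = #|porbits theta|.
Proof.
have := porbits_mul_tperm theta a b => /=.
rewrite contract_neq porbit_sym ab -/theta' /= => H; lia.
Qed.

(** The transposition count is read backwards: multiplying [theta'] by the same transposition gives
    [theta], which has one cycle more, so [a] and [b] must share a cycle of [theta']. *)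
Lemma contract_mem : b \in porbit theta' a.
Proof.
have := porbits_mul_tperm theta' a b => /=.
rewrite {1}/theta' tpermKg -contract_card contract_neq porbit_sym.
by case: (b \in _) => //= H; lia.
Qed.

Lemma contract_stable_tperm A x :
  stable theta' A -> (tperm a b x \in A) = (x \in A).
Proof.
move=> sA; have abA : (a \in A) = (b \in A).
  apply/idP/idP => H; first exact: stable_porbit sA H contract_mem.
  by apply: stable_porbit sA H _; rewrite porbit_sym contract_mem.
by case: tpermP => // ->.
Qed.

(** A [theta']-stable set contains both or neither of [a] and [b], so the transposition preserves
    it; and [theta] is that transposition followed by [theta']. *)
Lemma contract_stable A : stable theta' A -> stable theta A.
Proof.
move=> sA; apply/stableP => x xA; move/stableP: (sA) => /(_ (tperm a b x)).
by rewrite contract_stable_tperm // permM tpermK; apply.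
Qed.

Lemma contract_sub x : porbit theta x \subset porbit theta' x.
Proof.
apply/subsetP => y; apply: stable_porbit; last exact: porbit_id.
exact/contract_stable/porbit_stable.
Qed.

Lemma contract_connected iota :
  connected theta iota -> connected theta' (iota * tperm a b)%g.
Proof.
move=> con; apply/forallP => A; apply/implyP => /andP[tA iA].
have [->|[x xA]] := set_0Vmem A; first by rewrite eqxx.
apply/orP; right; apply/eqP.
apply: connectedP con (contract_stable tA) _ xA; apply/stableP => y yA.
by have /stableP/(_ _ yA) := iA; rewrite permM contract_stable_tperm.
Qed.

Lemma contract_porbit_out x : x \notin porbit theta a -> x \notin porbit theta b ->
  porbit theta' x = porbit theta x.
Proof.
move=> xa xb; apply/esym/eq_in_porbit => y yx; rewrite permM tpermD //.
  by apply: contraNneq xa => ay; rewrite ay porbit_sym.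
by apply: contraNneq xb => ay; rewrite ay porbit_sym.
Qed.

Lemma contract_porbit : porbit theta' a = porbit theta a :|: porbit theta b.
Proof.
apply/eqP; rewrite eqEsubset subUset contract_sub /=; apply/andP; split; last first.
  have /eqP <- : porbit theta' b == porbit theta' a by rewrite eq_porbit_mem contract_mem.
  exact: contract_sub.
apply/subsetP => y; apply: stable_porbit; last by rewrite inE porbit_id.
apply/stableP => x; rewrite permM !inE => xab.
have st u v := stableP _ _ (porbit_stable theta u) v.
case: tpermP => [_|_|_ _]; rewrite ?(st _ _ (porbit_id _ _)) ?orbT //.
by case/orP: xab => /st ->; rewrite ?orbT.
Qed.

Lemma contract_porbits : porbits theta' =
  (porbit theta a :|: porbit theta b) |:
    (porbits theta :\ porbit theta a :\ porbit theta b).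
Proof.
apply/setP => C; rewrite !inE.
apply/imsetP/idP => [[x _ ->]|].
- have [xa|xa] := boolP (x \in porbit theta' a).
    by rewrite -contract_porbit eq_porbit_mem xa.
  move: (xa); rewrite contract_porbit inE negb_or => /andP[xa' xb'].
  by rewrite contract_porbit_out // !eq_porbit_mem xa' xb' imset_f ?orbT.
- case/orP => [/eqP->|/and3P[Cb Ca /imsetP[x _ Ex]]].
    by exists a; rewrite // contract_porbit.
  by exists x; rewrite // contract_porbit_out // -eq_porbit_mem -Ex.
Qed.

End Contract.

(** * Removing one pair from an involution *)

Section CutPair.
Variables (iota : {perm T}) (a : T).
Hypothesis iotaK : involutive iota.
Let iota' := (iota * tperm a (iota a))%g.

Lemma cut_pairL : iota' a = a. Proof. by rewrite permM tpermR. Qed.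
Lemma cut_pairR : iota' (iota a) = iota a.
Proof. by rewrite permM iotaK tpermL. Qed.

Lemma cut_pairD x : x != a -> x != iota a -> iota' x = iota x.
Proof.
move=> xa xia; rewrite permM tpermD //.
  by apply: contraNneq xia => ->; rewrite iotaK.
by apply: contraNneq xa => /perm_inj ->.
Qed.

Lemma cut_pair_involutive : involutive iota'.
Proof.
move=> x; have [->|xa] := eqVneq x a; first by rewrite !cut_pairL.
have [->|xia] := eqVneq x (iota a); first by rewrite !cut_pairR.
rewrite (cut_pairD xa xia) cut_pairD ?iotaK //.
  by apply: contraNneq xia => <-; rewrite iotaK.
by apply: contraNneq xa => /perm_inj ->.
Qed.

Lemma cut_pair_fixed :
  [set x | iota' x == x] = [set x | iota x == x] :|: [set a; iota a].
Proof.
apply/setP => x; rewrite !inE.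
have [->|xa] := eqVneq x a; first by rewrite cut_pairL ?eqxx ?orbT.
have [->|xia] := eqVneq x (iota a); first by rewrite cut_pairR ?eqxx ?orbT.
by rewrite cut_pairD ?orbF.
Qed.

End CutPair.

(** * Counting non-loop edges *)

Definition nonloop theta iota := [set x | iota x \notin porbit theta x].

(** Otherwise every cycle of [theta] would be stable under both permutations, hence be all of [T],
    and there would be at most one. *)
Lemma connected_nonloop theta iota :
  connected theta iota -> 1 < #|porbits theta| ->
  exists a, iota a \notin porbit theta a.
Proof.
move=> con k1; apply/existsP; apply: contraLR k1; rewrite negb_exists => /forallP noloop.
have full x : porbit theta x = setT.
  apply: (connectedP con (porbit_stable _ _) _ (porbit_id theta x)).
  apply/stableP => y; rewrite -eq_porbit_mem => /eqP <-.
  by have := noloop y; rewrite negbK.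
rewrite -leqNgt -(cards1 [set: T]); apply/subset_leq_card/subsetP => C.
by case/imsetP=> x _ ->; rewrite full inE.
Qed.

(* A connected multigraph on k vertices has at least k - 1 non-loop edges; each
   of them contributes two half-edges. *)
Lemma card_nonloop theta iota :
  involutive iota -> connected theta iota ->
  (#|porbits theta|.-1).*2 <= #|nonloop theta iota|.
Proof.
have [k] := ubnP #|porbits theta|; elim: k theta iota => // k IHk theta iota kP iK con.
have [k1|k1] := leqP #|porbits theta| 1.
  by have -> : #|porbits theta|.-1 = 0 by lia.
have [a ab] := connected_nonloop con k1.
have kE := contract_card ab.
have := IHk _ _ _ (cut_pair_involutive a iK) (contract_connected ab con).
set N := #|nonloop _ _| => /(_ _)/wrap[]; first by lia.
(* Cycles only grow under contraction, so a non-loop half-edge afterwards was one before; [a] and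
   [iota a] come on top. *)
suff : N + 2 <= #|nonloop theta iota| by lia.
have abN : [set a; iota a] \subset nonloop theta iota.
  by rewrite subUset !sub1set !inE iK ab porbit_sym.
rewrite -(cardsID [set a; iota a] (nonloop theta iota)) addnC (setIidPr abN).
rewrite cards2 (contract_neq ab) leq_add2l; apply/subset_leq_card/subsetP => x.
rewrite !inE; have [->|xa] := eqVneq x a; first by rewrite cut_pairL porbit_id.
have [->|xia] := eqVneq x (iota a); first by rewrite cut_pairR ?porbit_id.
rewrite cut_pairD //=; apply: contraNN; apply/subsetP/contract_sub.
exact: ab.
Qed.

(** * Cycle counts under multiplication by an involution *)

Lemma card_setC_pair F a b : a \notin F -> b \notin F -> a != b ->
  #|~: (F :|: [set a; b])|.+2 = #|~: F|.
Proof.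
move=> aF bF ab; have abF : [set a; b] \subset ~: F.
  by rewrite subUset !sub1set !inE aF bF.
rewrite -(cardsID [set a; b] (~: F)) (setIidPr abF) cards2 ab.
by rewrite setDE -setCU add2n.
Qed.

Lemma card_porbits_mul_tperm_le theta a b :
  #|porbits (tperm a b * theta)| <= #|porbits theta|.+1.
Proof.
have /= := porbits_mul_tperm theta a b.
by case: (_ \notin _); case: (a != b); lia.
Qed.

(** An involution is a product of transpositions, one for every two moved points, and each raises
    the cycle count by at most one. *)
Lemma card_porbits_mul_involution iota theta : involutive iota ->
  #|porbits (iota * theta)|.*2 <= #|porbits theta|.*2 + #|~: [set x | iota x == x]|.
Proof.
have [m] := ubnP #|~: [set x | iota x == x]|.
elim: m iota theta => // m IHm iota theta mP iK.
have [a /negbTE ai|fixed] := pickP (fun x => iota x != x); last first.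
  suff -> : iota = 1%g by rewrite mul1g leq_addr.
  by apply/permP => x; rewrite perm1; apply/eqP; have /negbFE := fixed x.
have := card_setC_pair (F := [set x | iota x == x]) (a := a) (b := iota a).
rewrite !inE iK [a == _]eq_sym ai => /(_ isT isT isT).
rewrite -cut_pair_fixed // => mE.
have := card_porbits_mul_tperm_le theta a (iota a).
have := IHm _ (tperm a (iota a) * theta)%g _ (cut_pair_involutive a iK).
rewrite -!mulgA tpermKg => /(_ _)/wrap[]; first by rewrite -mE in mP; lia.
move: mE; set u := #|_|; set v := #|~: _|; set w := #|_|; set z := #|_|.
lia.
Qed.

(** * One cycle: noncrossing pairings *)

Lemma single_cycle_position theta : #|porbits theta| = 1 ->
  exists pos : T -> nat, injective pos /\
    forall x y, pos x < pos y -> pos (theta x) = (pos x).+1.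
Proof.
move/eqP/cards1P => [C cE].
have [x0 _ C0] : exists2 x0, x0 \in [set: T] & C = porbit theta x0.
  have : C \in porbits theta by rewrite cE inE.
  by case/imsetP => x0; exists x0; rewrite ?inE.
pose t := traject theta x0 #|C|.
have tT x : x \in t.
  rewrite /t C0 -porbit_traject -eq_porbit_mem -C0.
  by have : porbit theta x \in porbits theta by [apply: imset_f]; rewrite cE inE.
have ut : uniq t by rewrite /t C0 uniq_traject_porbit.
have posK x : nth x0 t (index x t) = x by rewrite nth_index.
exists (fun x => index x t); split=> [x y e|x y lt_xy].
  by rewrite -[x]posK e posK.
(* Since [y] comes later, [x] is not the last point listed, and its successor does not wrap round to
   [x0]. *)
have lty : (index x t).+1 < #|C|.
  by apply: leq_ltn_trans lt_xy _; rewrite -[#|C|](size_traject theta x0) index_mem.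
have -> : theta x = nth x0 t (index x t).+1.
  by rewrite -{1}[x]posK /t !nth_traject // ltnW.
by rewrite index_uniq // size_traject.
Qed.

(* F is the set of points left unmatched by contracted edges.  The number of
   edges is #|~: F| / 2, so the last condition is Euler's relation doubled. *)
Definition planar theta F : {set {perm T}} :=
  [set iota : {perm T} |
    [&& [forall x, iota (iota x) == x], [set x | iota x == x] == F,
        connected theta iota &
        (#|porbits theta| + #|porbits (iota * theta)|).*2 == #|~: F| + 4]].

Lemma planarP theta F iota :
  reflect [/\ involutive iota, [set x | iota x == x] = F,
              connected theta iota &
        (#|porbits theta| + #|porbits (iota * theta)|).*2 = #|~: F| + 4]
    (iota \in planar theta F).
Proof.
rewrite inE; apply: (iffP and4P) => -[iK iF con g]; split=> //.
- by move=> x; apply/eqP/(forallP iK).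
- exact/eqP.
- exact/eqP.
- by apply/forallP => x; apply/eqP.
- exact/eqP.
- exact/eqP.
Qed.

Section Loop.
Variables (theta : {perm T}) (F : {set T}) (pos : T -> nat).
Hypothesis theta1 : #|porbits theta| = 1.
Hypothesis pos_inj : injective pos.
Hypothesis posS : forall x y, pos x < pos y -> pos (theta x) = (pos x).+1.

(* Cutting the single cycle of theta at a crossing pair splits it and then
   merges it again, which loses two faces. *)
Lemma planar_noncrossing iota a c : iota \in planar theta F ->
  pos a < pos c < pos (iota a) -> pos a < pos (iota c) < pos (iota a).
Proof.
move=> /planarP[iK iF _ g] /andP[ac cb]; apply/negPn/negP => crossing.
have ca : c != a by apply: contraTneq ac => ->; rewrite ltnn.
have cia : c != iota a by apply: contraTneq cb => ->; rewrite ltnn.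
pose iota1 := (iota * tperm a (iota a))%g.
have i1K : involutive iota1 := cut_pair_involutive a iK.
have i1c : iota1 c = iota c by rewrite /iota1 cut_pairD.
(* This arc is closed under [theta1'], because the transposition sends its end [iota a] back to its
   start. It contains [c] but not [iota c], so the second transposition merges two cycles. *)
pose A := [set x | pos a < pos x <= pos (iota a)].
pose theta1' := (tperm a (iota a) * theta)%g.
have sA : stable theta1' A.
  apply/stableP => x; rewrite permM !inE.
  have aia : pos a < pos (iota a) := ltn_trans ac cb.
  case: tpermP => [->|_ _|xa xia]; first by rewrite ltnn.
    by rewrite (posS aia); lia.
  move=> /andP[ax xb].
  have xia' : pos x != pos (iota a) by apply: contra_not_neq xia => /pos_inj.
  by rewrite (@posS x (iota a)); lia.
have cA : c \in A by rewrite inE ac ltnW.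
have dA : iota c \notin A.
  rewrite inE; apply: contra crossing => /andP[->].
  rewrite leq_eqVlt => /orP[/eqP/pos_inj/perm_inj ca'|//].
  by rewrite ca' eqxx in ca.
have dc : iota1 c \notin porbit theta1' c.
  by rewrite i1c; apply: contra dA; apply: stable_porbit.
have card2 := contract_card dc.
have card1 := card_porbits_mul_tperm_le theta a (iota a).
rewrite -/theta1' theta1 in card1.
(* With m = [#|~: F|], both cuts leave at most one cycle and m - 4 moved points, so twice the number
   of faces is at most m - 2; Euler's relation demands m + 2. *)
have := card_porbits_mul_involution (tperm c (iota1 c) * theta1')
          (cut_pair_involutive c i1K).
have -> : (iota1 * tperm c (iota1 c) * (tperm c (iota1 c) * theta1'))%g
   = (iota * theta)%g.
  by rewrite /theta1' /iota1 -!mulgA !tpermKg.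
rewrite !cut_pair_fixed // iF.
have aF : a \notin F.
  rewrite -iF inE; apply: contraTneq (ltn_trans ac cb) => ->; by rewrite ltnn.
have iaF : iota a \notin F.
  by move: aF; rewrite -iF !inE iK eq_sym.
have cF : c \notin F.
  rewrite -iF inE; apply: contra dA => /eqP ->; exact: cA.
have icF : iota c \notin F.
  by move: cF; rewrite -iF !inE iK eq_sym.
have E1 : #|~: (F :|: [set a; iota a])|.+2 = #|~: F|.
  apply: card_setC_pair => //.
  by apply: contraTneq (ltn_trans ac cb) => <-; rewrite ltnn.
have := card_setC_pair (F := F :|: [set a; iota a]) (a := c) (b := iota1 c).
rewrite i1c !inE !negb_or cF icF ca cia /= => /(_ isT) E2.
have E3 : iota c != a by apply: contraNneq cia => <-; rewrite iK.
have E4 : iota c != iota a by apply: contraNneq ca => /perm_inj ->.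
have E5 : c != iota c by apply: contraNneq dA => <-.
move: E2; rewrite E3 E4 E5 => /(_ isT isT) E2.
rewrite i1c -/theta1' in card2 *.
rewrite theta1 in g; move: g card1 card2 E1 E2.
set n0 := #|porbits (iota * theta)|; set n1 := #|porbits (tperm c _ * _)|.
set n2 := #|porbits theta1'|; set n3 := #|~: F|.
set n4 := #|~: (_ :|: _)|; set n5 := #|~: (_ :|: _)|.
clearbody n0 n1 n2 n3 n4 n5; clear; lia.
Qed.

(** Induction on the length of a pair: a shortest disagreement would force a crossing in one of the
    two pairings. Fixed points are settled by the common [F]. *)
Lemma noncrossing_opener_inj iota1 iota2 :
  iota1 \in planar theta F -> iota2 \in planar theta F ->
  (forall x, (pos x < pos (iota1 x)) = (pos x < pos (iota2 x))) ->
  iota1 = iota2.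
Proof.
move=> P1 P2 op.
(* Quantifying over [i1] and [i2] lets the induction hypothesis be used with their roles exchanged.
   Openers suffice, as every closer is the partner of one. *)
suff opener d i1 i2 x : i1 \in planar theta F -> i2 \in planar theta F ->
    (forall x, (pos x < pos (i1 x)) = (pos x < pos (i2 x))) ->
    pos x < pos (i1 x) -> pos (i1 x) - pos x < d -> i2 x = i1 x.
  have [i1K F1 _ _] := planarP _ _ _ P1; have [i2K F2 _ _] := planarP _ _ _ P2.
  apply/permP => x; have [lt_x|lt_x|/pos_inj eq_x] := ltngtP (pos x) (pos (iota1 x)).
  - by apply/esym/opener; rewrite // ltnS.
  - have := @opener (pos x - pos (iota1 x)).+1 _ _ (iota1 x) P1 P2 op.
    rewrite i1K => /(_ lt_x (ltnSn _)) e; apply: (canRL i2K); exact: esym.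
  - have : x \in F by rewrite -F1 inE -eq_x.
    by rewrite -F2 inE -eq_x => /eqP.
elim: d i1 i2 x => // d IHd i1 i2 x p1 p2 opx ltx; rewrite ltnS => led.
have [i1K F1 _ _] := planarP _ _ _ p1; have [i2K F2 _ _] := planarP _ _ _ p2.
apply/eqP/negPn/negP => neq.
set y := i1 x in ltx led neq.
have i1y : i1 y = x by rewrite /y i1K.
pose z := i2 y; have i2z : i2 z = y by rewrite /z i2K.
have yz : pos z < pos y.
  (* As [y] is no opener of [i1], it is none of [i2], so its [i2]-partner [z] lies before it. *)
  have : ~~ (pos y < pos (i1 y)) by rewrite i1y; lia.
  rewrite opx -/z => yz; have : pos z != pos y; last by lia.
  apply: contraTneq ltx => /pos_inj zy; rewrite -leqNgt.
  have : y \in F by rewrite -F2 inE -/z zy.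
  by rewrite -F1 inE i1y => /eqP ->.
have zx : pos z != pos x.
  by apply: contraNneq neq => /pos_inj zx; rewrite -zx i2z.
(* If [z] lies inside the [i1]-pair, [i1] matches it inside by a shorter pair, on which both agree,
   against [i2 z = y]. If [z] precedes [x], then [i2] matches [x] by a shorter pair, and the
   exchanged hypothesis applies. *)
have [ltz|ltz] := ltnP (pos x) (pos z).
- have /andP[ltw1 ltw2] : pos x < pos (i1 z) < pos y.
    by apply: planar_noncrossing p1 _; rewrite ltz yz.
  have opz : pos z < pos (i1 z) by rewrite opx i2z.
  have : i2 z = i1 z by apply: IHd => //; lia.
  by rewrite i2z => e; rewrite -e ltnn in ltw2.
- have /andP[_ ltw2] : pos z < pos (i2 x) < pos (i2 z).
    by apply: planar_noncrossing p2 _; rewrite i2z; lia.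
  have opx2 : pos x < pos (i2 x) by rewrite -opx.
  move/eqP: neq; apply; apply/esym/IHd => //.
  by rewrite i2z in ltw2; lia.
Qed.

End Loop.

Lemma card_planar_single_cycle theta F : #|porbits theta| = 1 ->
  #|planar theta F| <= 2 ^ #|~: F|.
Proof.
move=> theta1; have [pos [pos_inj posS]] := single_cycle_position theta1.
pose openers (iota : {perm T}) := [set x | pos x < pos (iota x)].
rewrite -card_powerset -(card_in_imset (f := openers)); last first.
  move=> i1 i2 p1 p2 /setP e; apply: (noncrossing_opener_inj theta1 pos_inj posS p1 p2).
  by move=> x; have := e x; rewrite !inE.
apply/subset_leq_card/subsetP => O /imsetP[iota /planarP[_ iF _ _] ->].
rewrite inE; apply/subsetP => x; rewrite -iF !inE.
by apply: contraTneq => ->; rewrite ltnn.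
Qed.

(** * The recursion from edge contraction *)

Lemma planar_contract theta F iota a :
  iota \in planar theta F -> iota a \notin porbit theta a ->
  (iota * tperm a (iota a))%g \in
    planar (tperm a (iota a) * theta)%g (F :|: [set a; iota a]).
Proof.
move=> /planarP[iK iF con g] ab; have aia := contract_neq ab.
apply/planarP; split.
- exact: cut_pair_involutive.
- by rewrite cut_pair_fixed // iF.
- exact: contract_connected.
(* Faces are unchanged, [theta] loses one cycle and [~: F] two points, so both sides of the doubled
   Euler relation drop by two. *)
have := card_setC_pair (F := F) (a := a) (b := iota a).
rewrite -{1 2}iF !inE iK aia [_ == a]eq_sym aia => /(_ isT isT isT) mE.
rewrite -!mulgA tpermKg; move: g mE (contract_card ab).
set n0 := #|~: F|; set n1 := #|~: (_ :|: _)|; set n2 := #|porbits (_ * _)|.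
by set n3 := #|porbits (_ * _)|; set n4 := #|porbits _|; lia.
Qed.

(** Removing the prescribed pair is injective, being right multiplication by [tperm a b]. *)
Lemma card_planar_edge theta F a b : b \notin porbit theta a ->
  #|[set iota in planar theta F | iota a == b]| <=
  #|planar (tperm a b * theta) (F :|: [set a; b])|.
Proof.
move=> ab; rewrite -(card_imset _ (mulIg (tperm a b))).
apply/subset_leq_card/subsetP => _ /imsetP[iota + ->].
by rewrite inE => /andP[pl /eqP e]; rewrite -e planar_contract // e.
Qed.

(** Double counting of maps with a marked non-loop half-edge [a], where [b] is [iota a]. Half-edges
    rather than edges are marked, hence the doubling. *)
Lemma card_planar_rec theta F :
  (#|porbits theta|.-1).*2 * #|planar theta F| <=
  \sum_(a | a \notin F) \sum_(b | (b \notin F) && (b \notin porbit theta a))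
     #|planar (tperm a b * theta) (F :|: [set a; b])|.
Proof.
pose S (iota : {perm T}) := \sum_(a | a \notin F)
  \sum_(b | (b \notin F) && (b \notin porbit theta a)) (iota a == b : nat).
apply: (@leq_trans (\sum_(iota in planar theta F) S iota)).
  rewrite mulnC -sum_nat_const; apply: leq_sum => iota /planarP[iK iF con _].
  apply: leq_trans (card_nonloop iK con) _.
  rewrite -sum1_card big_mkcond [S _]big_mkcond /=; apply: leq_sum => a _.
  rewrite inE; case: ifP => // ab.
  have aF x : (x \notin F) = (iota x != x) by rewrite -iF inE.
  have ne := contract_neq ab.
  rewrite aF eq_sym ne (bigD1 (iota a)) ?eqxx //=.
  by rewrite aF iK ne ab.
rewrite exchange_big; apply: leq_sum => a aF.
rewrite exchange_big; apply: leq_sum => b /andP[bF ab].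
apply: leq_trans (card_planar_edge F ab).
rewrite -sum1dep_card big_mkcondr /=.
by apply: leq_sum => iota _; case: (_ == _).
Qed.

(** * Sums and products of cycle weights *)

Lemma sum_over_porbits theta F (P : pred {set T}) (g : {set T} -> nat) :
  \sum_(a | (a \notin F) && P (porbit theta a)) g (porbit theta a) =
  \sum_(C in porbits theta | P C) #|C :\: F| * g C.
Proof.
rewrite (partition_big (porbit theta) [pred C | (C \in porbits theta) && P C]) /=;
  last by move=> a /andP[_ ->]; rewrite imset_f.
apply: eq_bigr => C /andP[/imsetP[x _ ->] PC].
rewrite -sum_nat_const; apply: eq_big => [a|a /andP[_ /eqP->] //].
rewrite !inE -eq_porbit_mem.
by case: eqP => [->|_]; rewrite ?andbF // PC !andbT.
Qed.

Lemma sum_card_porbits theta F : \sum_(C in porbits theta) #|C :\: F| = #|~: F|.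
Proof.
transitivity (\sum_(C in porbits theta | true) #|C :\: F| * 1).
  by apply: eq_big => [C|C _]; rewrite ?andbT ?muln1.
rewrite -(sum_over_porbits theta F predT (fun=> 1)) /= -sum1_card.
by apply: eq_bigl => a; rewrite inE andbT.
Qed.

Definition orbit_weight theta F := \prod_(C in porbits theta) #|C :\: F|.

(** Bounds the orbit weight after merging [C] and [C']. The two endpoints removed by contraction are
    still counted, which gives the sum over all edges a closed form. *)
Definition pair_weight theta F C C' :=
  (#|C :\: F| + #|C' :\: F|) *
  \prod_(D in porbits theta :\ C :\ C') #|D :\: F|.

Lemma pair_weightE theta F C C' :
  C \in porbits theta -> C' \in porbits theta -> C' != C ->
  #|C :\: F| * (#|C' :\: F| * pair_weight theta F C C') =
  (#|C :\: F| + #|C' :\: F|) * orbit_weight theta F.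
Proof.
move=> cP cP' ne.
rewrite /orbit_weight (big_setD1 C) //= (big_setD1 C') /= ?inE ?ne //.
by rewrite [RHS]mulnCA; congr (_ * _); rewrite [RHS]mulnCA.
Qed.

(** Grouping [a] and [b] by cycle turns the sum into that of (m_i + m_j) times the orbit weight over
    ordered pairs of distinct cycles. *)
Lemma sum_pair_weight theta F :
  \sum_(a | a \notin F) \sum_(b | (b \notin F) && (b \notin porbit theta a))
    pair_weight theta F (porbit theta a) (porbit theta b) =
  (#|porbits theta|.-1).*2 * #|~: F| * orbit_weight theta F.
Proof.
set k := #|porbits theta|; set m := #|~: F|; set W := orbit_weight _ _.
pose w C := #|C :\: F|.
pose g C := \sum_(C' in porbits theta | C' != C) w C' * pair_weight theta F C C'.
have -> : \sum_(a | a \notin F) \sum_(b | (b \notin F) && (b \notin porbit theta a))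
    pair_weight theta F (porbit theta a) (porbit theta b) =
    \sum_(a | (a \notin F) && predT (porbit theta a)) g (porbit theta a).
  apply: eq_big => [a|a _]; first by rewrite andbT.
  rewrite /g -(sum_over_porbits theta F [pred C | C != porbit theta a]).
  by apply: eq_bigl => b; rewrite /= eq_porbit_mem.
rewrite sum_over_porbits /=.
(* For fixed [C], each of the k - 1 other cycles contributes [w C], and their own weights add up to
   [m - w C]. *)
transitivity (\sum_(C in porbits theta) (k.-1 * w C + (m - w C)) * W).
  apply: eq_big => [C|C /andP[CP _]]; first by rewrite andbT.
  rewrite /g big_distrr /=.
  transitivity (\sum_(C' in porbits theta | C' != C) (w C + w C') * W).
    by apply: eq_bigr => C' /andP[CP' ne]; apply: pair_weightE.
  rewrite -big_distrl big_split /=; congr (_ * _); congr (_ + _).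
    rewrite sum_nat_cond_const; congr (_ * _).
    rewrite /k (cardsD1 C (porbits theta)) CP /=; apply: eq_card => D.
    by rewrite !inE andbC.
  by rewrite /m -(sum_card_porbits theta F) (bigD1 C CP) /= addKn.
rewrite -big_distrl; congr (_ * _); rewrite big_split /=.
rewrite -big_distrr [in X in _ * X + _]sum_card_porbits -/m.
(* This bound makes the truncated subtraction exact. *)
have le C : C \in porbits theta -> w C <= m.
  by move=> CP; rewrite /m -(sum_card_porbits theta F) (bigD1 C CP) leq_addr.
have : \sum_(C in porbits theta) (m - w C) + m = k * m.
  rewrite -[X in _ + X](sum_card_porbits theta F) -big_split /= -sum_nat_const.
  by apply: eq_bigr => C /le; apply: subnK.
by rewrite -/m -/k; case: k => [|k'] /=; nia.
Qed.

Lemma orbit_weight_contract theta F a b : b \notin porbit theta a ->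
  orbit_weight (tperm a b * theta) (F :|: [set a; b]) <=
  pair_weight theta F (porbit theta a) (porbit theta b).
Proof.
move=> ab; rewrite /orbit_weight contract_porbits // big_setU1 /=; last first.
  rewrite !inE; apply/and3P => -[_ ne /imsetP[x _ e]].
  have : a \in porbit theta x by rewrite -e inE porbit_id.
  by rewrite -eq_porbit_mem -e eq_sym (negbTE ne).
apply: leq_mul.
  have [le _] := leq_card_setU (porbit theta a :\: F) (porbit theta b :\: F).
  apply: leq_trans le; apply/subset_leq_card.
  by rewrite -setDUl setDS // subsetUl.
apply: leq_prod => D; rewrite !inE => /and3P[Db Da /imsetP[x _ e]].
by apply/subset_leq_card; rewrite setDS // subsetUl.
Qed.

(** Serves the start of the induction, where contraction leaves one cycle and no other factor
    remains. *)
Lemma pair_weight_two theta F a b : b \notin porbit theta a ->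
  #|porbits theta| = 2 ->
  #|~: F| = pair_weight theta F (porbit theta a) (porbit theta b).
Proof.
move=> ab k2; rewrite -(sum_card_porbits theta F) /pair_weight.
have aP : porbit theta a \in porbits theta by exact: imset_f.
have bP : porbit theta b \in porbits theta by exact: imset_f.
have ne : porbit theta b != porbit theta a by rewrite eq_porbit_mem.
have rest0 : porbits theta :\ porbit theta a :\ porbit theta b = set0.
  apply/eqP; rewrite -cards_eq0; move/eqP: k2.
  by rewrite (cardsD1 (porbit theta a)) aP (cardsD1 (porbit theta b)) !inE ne bP.
rewrite (big_setD1 _ aP) (big_setD1 (porbit theta b)) ?inE ?ne //=.
by rewrite rest0 !big_set0 addn0 muln1.
Qed.

(** * The inductive bound *)

Lemma planar_size theta F iota : iota \in planar theta F ->
  (#|porbits theta|.-1).*2 <= #|~: F|.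
Proof.
move=> /planarP[iK iF con _]; apply: leq_trans (card_nonloop iK con) _.
apply/subset_leq_card/subsetP => x; rewrite -iF !inE.
by apply: contraNneq => ->; apply: porbit_id.
Qed.

Lemma card_planar_bound theta F : 1 < #|porbits theta| ->
  #|planar theta F| * 4 ^ #|porbits theta|.-1 <=
  orbit_weight theta F * #|~: F| ^ #|porbits theta|.-2 * 2 ^ #|~: F|.
Proof.
have [k] := ubnP #|porbits theta|; elim: k theta F => // k IHk theta F kP k1.
have [->|[iota pl]] := set_0Vmem (planar theta F); first by rewrite cards0.
have m2 := planar_size pl.
(* Losing two points divides 2^m by 4, which matches the power of 4. The extra factor m supplies the
   missing power of m when k > 2, and equals the pair weight when k = 2. *)
have edge a b : a \notin F -> b \notin F -> b \notin porbit theta a ->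
  #|~: F| * #|planar (tperm a b * theta) (F :|: [set a; b])|
      * 4 ^ #|porbits theta|.-1 <=
  pair_weight theta F (porbit theta a) (porbit theta b)
    * #|~: F| ^ #|porbits theta|.-2 * 2 ^ #|~: F|.
  move=> aF bF ab; have kE := contract_card ab.
  have mE := card_setC_pair aF bF (contract_neq ab).
  have wE := orbit_weight_contract F ab.
  have := card_planar_single_cycle (theta := tperm a b * theta) (F :|: [set a; b]).
  have := IHk (tperm a b * theta)%g (F :|: [set a; b]).
  have := pair_weight_two F ab; move: kE mE kP k1 wE.
  set kk := #|porbits theta|; set kk' := #|porbits _|.
  set m := #|~: F|; set m' := #|~: _|; set M := #|planar _ _|.
  set w := pair_weight _ _ _ _; set W := orbit_weight _ _.
  clearbody kk kk' m m' M w W; move=> {IHk iota pl m2 aF bF ab} <- <-.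
  case: kk' => [|[|j]] //= jk _ wE => [/(_ erefl) <- _ /(_ erefl) le1|_ + _].
    by rewrite muln1 expn1 !expnS; move: (2 ^ m') le1 => q le1; nia.
  move=> /(_ jk isT) /= le1.
  have le2 : m' ^ j <= m'.+2 ^ j by case: j {jk le1} => // j; rewrite leq_exp2r // !leqW.
  have {wE}le2 := leq_mul (leq_mul wE le2) (leqnn (2 ^ m')).
  have {le1}le3 := leq_trans le1 le2.
  rewrite (expnS 4 j.+1) (expnS m'.+2 j) (expnS 2 m'.+1) (expnS 2 m').
  by have := leq_mul (leqnn (4 * m'.+2)) le3; nia.
have m_gt0 : 0 < #|~: F| by lia.
(* The factor 2(k - 1) is that of the recursion; together with m it reappears in the sum of pair
   weights. *)
rewrite -(@leq_pmul2l ((#|porbits theta|.-1).*2 * #|~: F|)); last first.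
  by rewrite muln_gt0 m_gt0 double_gt0; lia.
apply: (@leq_trans (\sum_(a | a \notin F)
    \sum_(b | (b \notin F) && (b \notin porbit theta a))
      #|~: F| * #|planar (tperm a b * theta) (F :|: [set a; b])|
        * 4 ^ #|porbits theta|.-1)).
  under eq_bigr => a _ do rewrite -big_distrl -big_distrr /=.
  rewrite -big_distrl -big_distrr /= mulnA leq_mul2r mulnAC mulnC leq_mul2l.
  by rewrite card_planar_rec !orbT.
apply: (@leq_trans (\sum_(a | a \notin F)
    \sum_(b | (b \notin F) && (b \notin porbit theta a))
      pair_weight theta F (porbit theta a) (porbit theta b)
        * (#|~: F| ^ #|porbits theta|.-2 * 2 ^ #|~: F|))).
  apply: leq_sum => a aF; apply: leq_sum => b /andP[bF ab].
  by rewrite mulnA edge.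
under eq_bigr => a _ do rewrite -big_distrl /=.
by rewrite -big_distrl /= sum_pair_weight !mulnA.
Qed.

(** * Conjugation, transitivity and the passage from [Map0] to [planar] *)

Lemma porbit_conj s theta x :
  porbit (s ^ theta) (theta x) = [set theta y | y in porbit s x].
Proof.
have powE i : ((s ^ theta) ^+ i)%g (theta x) = theta ((s ^+ i)%g x).
  by rewrite -conjXg /conjg !permM permK.
apply/setP => y; apply/porbitP/imsetP => [[i ->]|[_ /porbitP[i ->] ->]].
  by exists ((s ^+ i)%g x); rewrite ?mem_porbit.
by exists i; rewrite powE.
Qed.

Lemma card_porbits_conj s theta : #|porbits (s ^ theta)| = #|porbits s|.
Proof.
have <- : [set [set theta y | y in C] | C : {set T} in porbits s] = porbits (s ^ theta).
  apply/setP => C; apply/imsetP/imsetP => [[_ /imsetP[x _ ->] ->]|[x _ ->]].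
    by exists (theta x); rewrite // porbit_conj.
  exists (porbit s (theta^-1 x)%g); first exact: imset_f.
  by rewrite -porbit_conj permKV.
by apply: card_imset; apply/imset_inj/perm_inj.
Qed.

(** A set stable under both generators is preserved by the whole group, so it contains the orbit of
    each of its points. *)
Lemma transitive_connected theta iota :
  [transitive <<[set theta; iota]>>, on [set: T] | 'P] -> connected theta iota.
Proof.
move=> tr; apply/forallP => A; apply/implyP => /andP[tA iA].
have [->|[x xA]] := set_0Vmem A; first by rewrite eqxx.
apply/orP; right; rewrite eqEsubset subsetT -(atransP tr x) ?inE //=.
have stab s : stable s A -> s \in ('N(A | 'P))%g.
  by move/stableP=> sA; rewrite !inE; apply/subsetP => y /sA; rewrite inE.
by rewrite acts_sub_orbit // gen_subG subUset !sub1set !stab.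
Qed.

End PlanarInvolutions.

Lemma Map0_planar (n : nat) (theta : 'S_n) : Map0 theta \subset planar theta set0.
Proof.
apply/subsetP => iota; rewrite inE => /and4P[/forallP fpf /eqP ord tr /eqP genus].
apply/planarP; split.
- by move=> x; rewrite -permM -[(_ * _)%g]/(iota ^+ 2)%g -ord expg_order perm1.
- by apply/setP => x; rewrite !inE (negbTE (fpf x)).
- exact: transitive_connected.
(* The two products are conjugate by [theta]; [planar] uses the order in which contraction cancels
   its transpositions. *)
have -> : #|porbits (iota * theta)%g| = #|porbits (theta * iota)%g|.
  by rewrite -(card_porbits_conj (theta * iota) theta) /conjg mulgA mulKg.
rewrite setC0 cardsT card_ord; apply/eqP; rewrite -(eqr_nat rat).
move: genus; rewrite /ncycles -muln2 natrM !natrD => ->.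
by apply/eqP; field.
Qed.

Theorem corollary1p2 (k n : nat) (ns : 'I_k -> nat) (theta : 'S_n)
    (hk : (1 <= k)%N)
    (hns : forall i : 'I_k, (0 < ns i)%N)
    (hn : n = (\sum_(i < k) ns i)%N)
    (htheta : perm_eq (cycle_lengths theta) [seq ns i | i <- enum 'I_k]) :
  #|Map0 theta|%:R <=
    (\prod_(i < k) ns i)%N%:R * n%:R ^ (k%:Z - 2) * 2%:R ^ (n%:Z - 2 * k%:Z + 2)
      * (2 * k - 2 <= n)%N%:R :> rat.
Proof.
have kE : #|porbits theta| = k.
  have := perm_size htheta; rewrite /cycle_lengths 2!size_map size_enum_ord.
  by rewrite -cardE.
have wE : orbit_weight theta set0 = (\prod_(i < k) ns i)%N.
  have := perm_big (x := 1%N) (op := muln) (P := predT) (F := id) _ htheta.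
  rewrite /cycle_lengths 2!big_map => prodE.
  rewrite /orbit_weight -big_enum -[RHS]big_enum; apply: etrans prodE.
  by apply: eq_bigr => C _; rewrite setD0.
have mE : #|~: (set0 : {set 'I_n})| = n by rewrite setC0 cardsT card_ord.
have le0 := subset_leq_card (Map0_planar theta).
have [le_kn|lt_nk] := leqP; last first.
  (* Fewer than 2k - 2 points cannot carry the required k - 1 non-loop edges, so the set is
     empty. *)
  have [->|[iota pl]] := set_0Vmem (Map0 theta); first by rewrite cards0 mulr0.
  have := planar_size (subsetP (Map0_planar theta) _ pl).
  by rewrite kE mE; lia.
rewrite mulr1.
(* For k = 1 the product p is n and cancels the power n^(-1), and the exponent of 2 is n. *)
have [k1|k2] := leqP k 1.
  have {}k1 : k = 1%N by lia.
  have := card_planar_single_cycle set0 (etrans kE k1); rewrite mE => le1.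
  have pE : (\prod_(i < k) ns i)%N = n.
    by rewrite [RHS]hn; move: ns {hns hn htheta wE}; rewrite k1 => f; rewrite !big_ord1.
  have n0 : n%:R != 0 :> rat.
    by rewrite pnatr_eq0 -lt0n -pE prodn_gt0.
  have -> : k%:Z - 2 = -1 by lia.
  have -> : n%:Z - 2 * k%:Z + 2 = n%:Z by lia.
  rewrite pE exprN1 mulfV // mul1r.
  by rewrite -exprnP -natrX ler_nat (leq_trans le0).
have := card_planar_bound (theta := theta) set0; rewrite kE mE wE => /(_ k2) le1.
(* Now both integer exponents are nonnegative, so the inequality descends to natural numbers. *)
have -> : k%:Z - 2 = k.-2%:Z by lia.
have -> : n%:Z - 2 * k%:Z + 2 = (n - (k.-1).*2)%N%:Z by lia.
rewrite -!exprnP -!natrX -!natrM ler_nat (leq_trans le0) //.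
(* Multiplying by 4^(k-1) turns 2^(n-2k+2) into 2^n. *)
rewrite -(@leq_pmul2r (4 ^ k.-1)) ?expn_gt0 //; apply: leq_trans le1 _.
rewrite -[leqRHS]mulnA leq_mul2l (_ : 4 = 2 ^ 2)%N // -expnM -expnD.
by rewrite leq_exp2l //; apply/orP; right; lia.
Qed.
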